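(* Let $n\in\mathbb{N}=\{1,2,3,\dots\}$ and let $\nu\in\mathbb{R}$ with $n-1<\nu<n$. Then the C-Legendre function $P_\nu$ satisfies, for all $x\in(-1,1)$, $$(1-x^2)P_\nu''(x)-2xP_\nu'(x)+\nu(\nu+1)P_\nu(x)=0 .$$
   Context: For $n\in\mathbb{N}$, $n-1<\nu<n$ and $x>a$, the Caputo fractional derivative of order $\nu$ with lower terminal $a$ is $${}_aD^\nu_*f(x)=\frac{1}{\Gamma(n-\nu)}\int_a^x\frac{f^{(n)}(\tau)}{(x-\tau)^{\nu+1-n}}\,d\tau .$$ For $n-1<\nu<n$ and $x\in(-1,1)$ the C-Legendre function is defined by $$P_\nu(x)=\frac{(-1)^\nu}{2^\nu\,\Gamma(\nu+1)}\;{}_{-1}D^\nu_*\left[(1-x^2)^{\nu}\right],$$ where $(-1)^s:=e^{i\pi s}$ for real $s$. *)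

(* Defs.v *)
From Stdlib Require Import Reals.
From Coquelicot Require Import Coquelicot.
Open Scope R_scope.

(** Euler's integral, used only for [0 < s]. *)
Definition Gamma (s : R) : R :=
  RInt_gen (fun t => Rpower t (s - 1) * exp (- t))
           (at_right 0) (Rbar_locally p_infty).

(** Meant for [INR n - 1 < nu < INR n] and [a < x].  The integrand may be
    singular at both endpoints, so the integral is improper at [a] and at [x].
    [Rpower] is the usual power on positive bases, and [0 < x - tau] on the
    whole open interval of integration. *)
Definition caputo (n : nat) (nu a : R) (f : R -> R) (x : R) : R :=
  / Gamma (INR n - nu) *
  RInt_gen (fun tau => Derive_n f n tau / Rpower (x - tau) (nu + 1 - INR n))
           (at_right a) (at_left x).

Definition Cexp (z : C) : C :=
  (exp (Re z) * (cos (Im z), sin (Im z)))%C.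

Definition neg1_pow (s : R) : C := Cexp (Ci * (PI * s))%C.

(** Meant for [INR n - 1 < nu < INR n] and [-1 < x < 1].  Only values of the
    function [t |-> (1 - t^2)^nu] on (-1, x), where [0 < 1 - t^2], matter. *)
Definition C_Legendre (n : nat) (nu : R) (x : R) : C :=
  (neg1_pow nu / (Rpower 2 nu * Gamma (nu + 1))%R
   * caputo n nu (-1) (fun t => Rpower (1 - t ^ 2) nu) x)%C.

(** Derivative of a complex-valued function of a real variable. *)
Definition is_deriveRC (f : R -> C) (x : R) (l : C) : Prop :=
  is_derive (V := C_R_NormedModule) f x l.

(* Main.v *)
Require Import Defs.
From Stdlib Require Import Reals Lra Lia.
From Coquelicot Require Import Coquelicot.
Open Scope R_scope.

(** Put [u = 1 + x].  The idea is to show that the Caputo derivative of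
    [(1 - x^2)^nu = u^nu (2 - u)^nu] is a constant multiple of a power series
    in [u], essentially [2F1 (-nu, nu + 1; 1; u / 2)], and to read the Legendre
    equation off the ratio of its consecutive coefficients.

    Expanding [(2 - u)^nu] in a binomial series of radius 2
    ([binomial_series]), each derivation lowers the exponent of [u^nu] by one
    and multiplies the coefficients by a linear factor, so that the n-th
    derivative is [u^(nu - n)] times a power series of radius at least 2
    ([Derive_n_one_minus_sqr_pow]).

    With [a = nu - n + 1], which lies in (0, 1), the integral to compute is
    therefore that of [(t + 1)^(a - 1) (x - t)^(-a)] against a power series in
    [t + 1].  The exponents of this kernel add up to -1, so its integral [M]
    over (-1, x) is the same for every [x] ([beta_integral_scale_free]);
    integration by parts gives the moments
    [M (1 + x)^k (a)_k / k!] ([beta_moments]); and the series may be integrated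
    term by term, because it converges uniformly on [[0, 1 + x]] while the
    kernel is integrable ([beta_integral_PSeries]).

    The resulting coefficients [s_k] satisfy
    [2 (k + 1)^2 s_(k+1) = (k - nu) (k + nu + 1) s_k] ([legendre_coef_ratio]).
    In terms of the Euler operator [theta = u d/du] this says
    [2 (theta S)' = (theta - nu) (theta + nu + 1) S], which is the Legendre
    equation ([legendre_series_ode]).  As [nu] is not an integer no coefficient
    vanishes, and the ratio test gives radius 2, which covers -1 < x < 1. *)

(** * The Euler operator on power series *)

(** [alpha + u d/du], acting on coefficients. *)
Definition euler (alpha : R) (s : nat -> R) (k : nat) : R :=
  (alpha + INR k) * s k.

Lemma euler_split alpha s k :
  euler alpha s k = PS_plus (PS_scal alpha s) (PS_incr_1 (PS_derive s)) k.
Proof.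
  destruct k as [|k].
  - change ((alpha + 0) * s O = alpha * s O + 0). ring.
  - change ((alpha + INR (S k)) * s (S k)
            = alpha * s (S k) + INR (S k) * s (S k)). ring.
Qed.

Lemma CV_radius_euler alpha s :
  Rbar_le (CV_radius s) (CV_radius (euler alpha s)).
Proof.
  rewrite (CV_radius_ext _ _ (euler_split alpha s)).
  refine (Rbar_le_trans _ _ _ _ (CV_radius_plus _ _)).
  rewrite CV_radius_incr_1, CV_radius_derive.
  apply Rbar_min_case; [|apply Rbar_le_refl].
  destruct (Req_dec alpha 0) as [->|Ha].
  - rewrite (CV_radius_ext (PS_scal 0 s) (fun _ => 0)).
    + rewrite CV_radius_const_0. destruct (CV_radius s); simpl; trivial.
    + intro k. unfold PS_scal, scal; simpl; unfold mult; simpl; ring.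
  - rewrite CV_radius_scal by trivial. apply Rbar_le_refl.
Qed.

Lemma PSeries_euler alpha s u :
  Rbar_lt (Rabs u) (CV_radius s) ->
  PSeries (euler alpha s) u =
  alpha * PSeries s u + u * PSeries (PS_derive s) u.
Proof.
  intro Hu.
  rewrite (PSeries_ext _ _ u (euler_split alpha s)), PSeries_plus.
  - now rewrite PSeries_scal, PSeries_incr_1.
  - apply ex_pseries_scal; [apply Rmult_comm|]. now apply CV_radius_inside.
  - apply ex_pseries_incr_1, ex_pseries_derive, Hu.
Qed.

(** * Power series given by a ratio recurrence *)

Lemma CV_radius_ratio (a r : nat -> R) (l : R) :
  0 < l ->
  a O <> 0 ->
  (forall k, r k <> 0) ->
  (forall k, a (S k) = r k * a k) ->
  is_lim_seq r l ->
  CV_radius a = / l.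
Proof.
  intros Hl Ha0 Hr Ha Hlim.
  assert (Hnz : forall k, a k <> 0).
  { induction k as [|k IH]; trivial. rewrite Ha.
    now apply Rmult_integral_contrapositive_currified. }
  apply CV_radius_finite_DAlembert; trivial.
  apply is_lim_seq_ext with (fun k => Rabs (r k)).
  - intro k. rewrite Ha. f_equal. now field.
  - rewrite <- (Rabs_pos_eq l) by lra.
    exact (is_lim_seq_abs _ _ Hlim).
Qed.

Lemma is_lim_seq_ratio_1 (c : R) :
  is_lim_seq (fun k => 1 + c / (INR k + 1)) 1.
Proof.
  replace (Finite 1) with (Finite (1 + c * 0)) by (f_equal; ring).
  apply is_lim_seq_plus'; [apply is_lim_seq_const|].
  apply is_lim_seq_mult'; [apply is_lim_seq_const|].
  replace (Finite 0) with (Rbar_inv p_infty) by trivial.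
  apply is_lim_seq_inv; [|discriminate].
  apply is_lim_seq_ext with (fun k => INR (S k)).
  - intro k. apply S_INR.
  - apply (is_lim_seq_incr_1 INR), is_lim_seq_INR.
Qed.

(** * The binomial series of (2 - u)^nu *)

(** [binom_coef nu k] is [2^nu (-1/2)^k] times the generalised binomial
    coefficient [nu (nu - 1) ... (nu - k + 1) / k!]. *)
Fixpoint binom_coef (nu : R) (k : nat) : R :=
  match k with
  | O => Rpower 2 nu
  | S k => (INR k - nu) / (2 * (INR k + 1)) * binom_coef nu k
  end.

Lemma INR_S_gt0 k : 0 < INR k + 1.
Proof. generalize (pos_INR k); lra. Qed.

Lemma CV_radius_binom nu :
  (forall k, INR k - nu <> 0) -> CV_radius (binom_coef nu) = 2.
Proof.
  intro Hnu.
  replace (Finite 2) with (Rbar_inv (1 / 2)) by (simpl; f_equal; field).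
  apply (CV_radius_ratio _ (fun k => (INR k - nu) / (2 * (INR k + 1)))).
  - lra.
  - simpl. apply Rgt_not_eq, exp_pos.
  - intro k. generalize (INR_S_gt0 k); intro.
    apply Rmult_integral_contrapositive_currified; trivial.
    apply Rinv_neq_0_compat; lra.
  - trivial.
  - apply is_lim_seq_ext with (fun k => 1 / 2 * (1 + (- (nu + 1)) / (INR k + 1))).
    + intro k. generalize (INR_S_gt0 k); intro. field. lra.
    + replace (Finite (1 / 2)) with (Finite (1 / 2 * 1)) by (f_equal; ring).
      apply is_lim_seq_mult'; [apply is_lim_seq_const|apply is_lim_seq_ratio_1].
Qed.

Lemma is_derive_Rpower (p x : R) :
  0 < x -> is_derive (fun y => Rpower y p) x (p * Rpower x (p - 1)).
Proof. intro. now apply is_derive_Reals, derivable_pt_lim_power. Qed.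

Lemma Rpower_minus_1 x p : 0 < x -> Rpower x p = x * Rpower x (p - 1).
Proof.
  intro Hx. rewrite <- (Rpower_1 x) at 2 by trivial.
  rewrite <- Rpower_plus. f_equal; ring.
Qed.

Lemma Rpower_pos x p : 0 < Rpower x p.
Proof. apply exp_pos. Qed.

(** The coefficients say [2 S' = u S' - nu S], so [S (2 - u)^(-nu)] has zero
    derivative; its value at 0 is 1. *)
Lemma binomial_series nu u :
  (forall k, INR k - nu <> 0) -> 0 <= u < 2 ->
  PSeries (binom_coef nu) u = Rpower (2 - u) nu.
Proof.
  intros Hnu Hu.
  set (S := PSeries (binom_coef nu)).
  assert (Hr := CV_radius_binom nu Hnu).
  assert (Hin : forall v, 0 <= v < 2 -> Rbar_lt (Rabs v) (CV_radius (binom_coef nu))).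
  { intros v Hv. rewrite Hr. simpl. rewrite Rabs_pos_eq; lra. }
  set (q := fun v => S v * Rpower (2 - v) (- nu)).
  assert (Hq : forall v, 0 <= v < 2 -> is_derive q v 0).
  { intros v Hv. unfold q.
    assert (HS : is_derive S v (PSeries (PS_derive (binom_coef nu)) v)).
    { apply is_derive_PSeries, Hin, Hv. }
    assert (HR : is_derive (fun y => Rpower (2 - y) (- nu)) v
                  (- (- nu * Rpower (2 - v) (- nu - 1)))).
    { evar_last.
      - apply (is_derive_comp (fun y => Rpower y (- nu)) (fun y => 2 - y)).
        + apply is_derive_Rpower; lra.
        + auto_derive; trivial.
      - unfold scal; simpl; unfold mult; simpl. ring. }
    evar_last; [exact (is_derive_mult _ _ _ _ _ HS HR Rmult_comm)|].
    assert (E : 2 * PSeries (PS_derive (binom_coef nu)) v =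
                - nu * S v + v * PSeries (PS_derive (binom_coef nu)) v).
    { unfold S. rewrite <- PSeries_euler by now apply Hin.
      rewrite <- PSeries_scal. apply PSeries_ext. intro k.
      unfold PS_scal, PS_derive, euler, scal; cbn -[INR]; unfold mult; cbn -[INR].
      generalize (INR_S_gt0 k); intro. rewrite S_INR. field. lra. }
    change (PSeries (PS_derive (binom_coef nu)) v * Rpower (2 - v) (- nu)
            + S v * - (- nu * Rpower (2 - v) (- nu - 1)) = 0).
    rewrite (Rpower_minus_1 (2 - v) (- nu)) by lra.
    replace (PSeries (PS_derive (binom_coef nu)) v) with (- nu * S v / (2 - v)).
    - field. lra.
    - apply (Rmult_eq_reg_l (2 - v)); [|lra].
      replace ((2 - v) * (- nu * S v / (2 - v))) with (- nu * S v) by (field; lra).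
      lra. }
  assert (Hq0 : q u = 1).
  { assert (q0 : q 0 = 1).
    { unfold q, S. rewrite PSeries_0. simpl binom_coef.
      rewrite Rminus_0_r, <- Rpower_plus.
      replace (nu + - nu) with 0 by ring. apply Rpower_O; lra. }
    destruct (Req_dec u 0) as [->|Hu0]; trivial.
    rewrite <- q0. symmetry. apply (eq_is_derive q 0 u); [|lra].
    intros t Ht. apply Hq. lra. }
  unfold q in Hq0.
  apply (Rmult_eq_reg_r (Rpower (2 - u) (- nu))).
  - rewrite Hq0, <- Rpower_plus.
    replace (nu + - nu) with 0 by ring. symmetry; apply Rpower_O; lra.
  - apply Rgt_not_eq, Rpower_pos.
Qed.

(** * Derivatives of (1 - t^2)^nu *)

Lemma locally_between (A B x : R) : A < x < B -> locally x (fun y => A < y < B).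
Proof.
  intro Hx. apply (locally_interval _ x A B); simpl; intros; lra.
Qed.

(** Since [(u^alpha S)' = u^(alpha - 1) (alpha S + u S')], differentiating
    [u^alpha S] applies [euler alpha] to the coefficients of [S]. *)
Fixpoint deriv_coef (nu : R) (j : nat) : nat -> R :=
  match j with
  | O => binom_coef nu
  | S j => euler (nu - INR j) (deriv_coef nu j)
  end.

Lemma CV_radius_deriv_coef nu j :
  (forall k, INR k - nu <> 0) -> Rbar_le 2 (CV_radius (deriv_coef nu j)).
Proof.
  intro Hnu. induction j as [|j IH]; simpl deriv_coef.
  - rewrite CV_radius_binom by trivial. apply Rbar_le_refl.
  - eapply Rbar_le_trans; [exact IH|apply CV_radius_euler].
Qed.

Lemma Rabs_lt_CV_radius a u :
  Rbar_le 2 (CV_radius a) -> 0 <= u < 2 -> Rbar_lt (Rabs u) (CV_radius a).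
Proof.
  intros Ha Hu. eapply Rbar_lt_le_trans; [|exact Ha].
  simpl. rewrite Rabs_pos_eq; lra.
Qed.

Lemma Derive_n_one_minus_sqr_pow nu j t :
  (forall k, INR k - nu <> 0) -> -1 < t < 1 ->
  Derive_n (fun y => Rpower (1 - y ^ 2) nu) j t =
  Rpower (t + 1) (nu - INR j) * PSeries (deriv_coef nu j) (t + 1).
Proof.
  intro Hnu. revert t. induction j as [|j IH]; intros t Ht.
  - cbn [Derive_n deriv_coef INR]. rewrite binomial_series by (trivial; lra).
    rewrite Rminus_0_r, Rpower_mult_distr by lra. f_equal. ring.
  - cbn [Derive_n].
    rewrite (Derive_ext_loc _ (fun y => Rpower (y + 1) (nu - INR j) *
               PSeries (deriv_coef nu j) (y + 1))).
    + apply is_derive_unique.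
      assert (Hin : Rbar_lt (Rabs (t + 1)) (CV_radius (deriv_coef nu j))).
      { apply Rabs_lt_CV_radius; [now apply CV_radius_deriv_coef|lra]. }
      evar_last.
      * apply (is_derive_comp (fun y => Rpower y (nu - INR j) * PSeries (deriv_coef nu j) y)
                 (fun y => y + 1)).
        -- apply (is_derive_mult (fun y => Rpower y (nu - INR j)) (PSeries (deriv_coef nu j))).
           ++ apply is_derive_Rpower. lra.
           ++ apply is_derive_PSeries, Hin.
           ++ apply Rmult_comm.
        -- auto_derive; trivial.
      * cbn [deriv_coef]. rewrite PSeries_euler by exact Hin.
        rewrite (Rpower_minus_1 (t + 1) (nu - INR j)) by lra.
        rewrite S_INR. replace (nu - (INR j + 1)) with (nu - INR j - 1) by ring.
        unfold plus, scal, mult; simpl; unfold mult; simpl. ring.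
    + generalize (locally_between (-1) 1 t Ht).
      apply filter_imp. intros y Hy. now apply IH.
Qed.

(** * The Legendre series *)

(** [(a)_k / k!], the quotient of the Beta values [B(a + k, 1 - a)] and
    [B(a, 1 - a)]. *)
Fixpoint moment_coef (a : R) (k : nat) : R :=
  match k with
  | O => 1
  | S k => (a + INR k) / (INR k + 1) * moment_coef a k
  end.

Definition legendre_coef (nu : R) (n k : nat) : R :=
  deriv_coef nu n k * moment_coef (nu - INR n + 1) k.

(** The factors [nu - i + k], [i < j], shift to [nu - i + k + 1] when [k]
    increases, so all but the outermost two cancel in the ratio. *)
Lemma deriv_coef_ratio nu j k :
  (nu - INR j + 1 + INR k) * deriv_coef nu j (S k) =
  (nu + INR k + 1) * ((INR k - nu) / (2 * (INR k + 1))) * deriv_coef nu j k.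
Proof.
  induction j as [|j IH].
  - cbn [deriv_coef binom_coef INR]. ring.
  - cbn [deriv_coef]. unfold euler. rewrite !S_INR.
    replace (nu - (INR j + 1) + 1 + INR k) with (nu - INR j + INR k) by ring.
    transitivity ((nu - INR j + INR k) *
      ((nu - INR j + 1 + INR k) * deriv_coef nu j (S k))); [ring|].
    rewrite IH. ring.
Qed.

(** The factor [nu - n + 1 + k] coming from the n-th derivative cancels against
    that of the moments, which makes the ratio independent of [n]. *)
Lemma legendre_coef_ratio nu n k :
  legendre_coef nu n (S k) =
  (INR k - nu) * (nu + 1 + INR k) / (2 * (INR k + 1) ^ 2) * legendre_coef nu n k.
Proof.
  unfold legendre_coef. cbn [moment_coef].
  generalize (INR_S_gt0 k); intro.
  transitivity ((nu - INR n + 1 + INR k) * deriv_coef nu n (S k)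
      * (moment_coef (nu - INR n + 1) k / (INR k + 1))); [field; lra|].
  rewrite deriv_coef_ratio. field. lra.
Qed.

Lemma deriv_coef_0_neq nu j :
  (forall k, INR k - nu <> 0) -> deriv_coef nu j O <> 0.
Proof.
  intro Hnu. induction j as [|j IH]; cbn [deriv_coef].
  - apply Rgt_not_eq, Rpower_pos.
  - unfold euler. apply Rmult_integral_contrapositive_currified; trivial.
    generalize (Hnu j). simpl. lra.
Qed.

Lemma CV_radius_legendre_coef nu n :
  0 < nu -> (forall k, INR k - nu <> 0) ->
  CV_radius (legendre_coef nu n) = 2.
Proof.
  intros Hpos Hnu.
  replace (Finite 2) with (Rbar_inv (1 / 2)) by (simpl; f_equal; field).
  apply (CV_radius_ratio _
    (fun k => (INR k - nu) * (nu + 1 + INR k) / (2 * (INR k + 1) ^ 2))).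
  - lra.
  - unfold legendre_coef. cbn [moment_coef]. rewrite Rmult_1_r.
    now apply deriv_coef_0_neq.
  - intro k. generalize (INR_S_gt0 k); intro.
    apply Rmult_integral_contrapositive_currified.
    + apply Rmult_integral_contrapositive_currified; [trivial|lra].
    + apply Rinv_neq_0_compat. apply Rgt_not_eq.
      apply Rmult_lt_0_compat; [lra|]. now apply pow_lt.
  - intro k. apply legendre_coef_ratio.
  - apply is_lim_seq_ext with
      (fun k => 1 / 2 * (1 + (- (nu + 1)) / (INR k + 1)) * (1 + nu / (INR k + 1))).
    + intro k. generalize (INR_S_gt0 k); intro. field. lra.
    + replace (Finite (1 / 2)) with (Finite (1 / 2 * 1 * 1)) by (f_equal; ring).
      apply is_lim_seq_mult'; [|apply is_lim_seq_ratio_1].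
      apply is_lim_seq_mult'; [apply is_lim_seq_const|apply is_lim_seq_ratio_1].
Qed.

(** With [theta = u d/du] and [w = (theta + nu + 1) S], the coefficient ratio
    reads [2 (1 + theta) S' = (theta - nu) w]; expanding the Euler operators
    leaves the Legendre operator in the variable [u]. *)
Lemma legendre_series_ode nu n u :
  0 < nu -> (forall k, INR k - nu <> 0) -> 0 <= u < 2 ->
  let s := legendre_coef nu n in
  u * (2 - u) * PSeries (PS_derive (PS_derive s)) u
  - 2 * (u - 1) * PSeries (PS_derive s) u + nu * (nu + 1) * PSeries s u = 0.
Proof.
  intros Hpos Hnu Hu s.
  assert (Hr : Rbar_le 2 (CV_radius s)).
  { unfold s. rewrite CV_radius_legendre_coef by trivial. apply Rbar_le_refl. }
  assert (Hin : Rbar_lt (Rabs u) (CV_radius s)) by now apply Rabs_lt_CV_radius.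
  set (w := euler (nu + 1) s).
  assert (Hw : Rbar_lt (Rabs u) (CV_radius w)).
  { eapply Rbar_lt_le_trans; [exact Hin|apply CV_radius_euler]. }
  assert (Hs' : Rbar_lt (Rabs u) (CV_radius (PS_derive s))).
  { now rewrite CV_radius_derive. }
  assert (E : 2 * PSeries (euler 1 (PS_derive s)) u = PSeries (euler (- nu) w) u).
  { rewrite <- PSeries_scal. apply PSeries_ext. intro k.
    unfold PS_scal, w, euler, PS_derive, scal; cbn -[INR]; unfold mult; cbn -[INR].
    unfold s. rewrite legendre_coef_ratio, S_INR.
    generalize (INR_S_gt0 k); intro. field. lra. }
  assert (W : PSeries (PS_derive w) u =
      (nu + 2) * PSeries (PS_derive s) u + u * PSeries (PS_derive (PS_derive s)) u).
  { rewrite <- PSeries_euler by trivial. apply PSeries_ext. intro k.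
    unfold w, euler, PS_derive. rewrite !S_INR. ring. }
  rewrite !PSeries_euler, W in E by trivial.
  unfold w in E. rewrite PSeries_euler in E by trivial.
  lra.
Qed.

(** * Improper integrals on a bounded interval *)

Lemma at_left_lt (A B : R) : A < B -> at_left B (fun t => A < t < B).
Proof.
  intro H. assert (He : 0 < B - A) by lra.
  exists (mkposreal _ He). intros y Hy Hlt.
  unfold ball in Hy; simpl in Hy. unfold AbsRing_ball, abs, minus, plus, opp in Hy.
  simpl in Hy. apply Rabs_def2 in Hy. lra.
Qed.

Lemma at_right_gt (A B : R) : A < B -> at_right A (fun t => A < t < B).
Proof.
  intro H. assert (He : 0 < B - A) by lra.
  exists (mkposreal _ He). intros y Hy Hlt.
  unfold ball in Hy; simpl in Hy. unfold AbsRing_ball, abs, minus, plus, opp in Hy.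
  simpl in Hy. apply Rabs_def2 in Hy. lra.
Qed.

Lemma eventually_inside (A B : R) (P : R * R -> Prop) :
  A < B ->
  (forall s t, A < s -> s < t -> t < B -> P (s, t)) ->
  filter_prod (at_right A) (at_left B) P.
Proof.
  intros HAB HP.
  apply (Filter_prod _ _ _ (fun s => A < s < (A + B) / 2)
                           (fun t => (A + B) / 2 < t < B)).
  - apply at_right_gt; lra.
  - apply at_left_lt; lra.
  - intros s t Hs Ht. apply HP; lra.
Qed.

Lemma is_RInt_gen_antideriv (A B : R) (H h : R -> R) (la lb : R) :
  A < B ->
  (forall t, A < t < B -> is_derive H t (h t)) ->
  (forall t, A < t < B -> continuous h t) ->
  filterlim H (at_right A) (locally la) ->
  filterlim H (at_left B) (locally lb) ->
  is_RInt_gen h (at_right A) (at_left B) (lb - la).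
Proof.
  intros HAB HH Hh HA HB.
  apply (is_RInt_gen_ext (Derive H)).
  { apply eventually_inside; trivial. intros s t Hs Hst Ht x; simpl.
    rewrite Rmin_left, Rmax_right by lra. intro Hx.
    apply is_derive_unique, HH. lra. }
  apply is_RInt_gen_Derive; trivial.
  - apply eventually_inside; trivial. intros s t Hs Hst Ht x; simpl.
    rewrite Rmin_left, Rmax_right by lra. intro Hx.
    exists (h x). apply HH. lra.
  - apply eventually_inside; trivial. intros s t Hs Hst Ht x; simpl.
    rewrite Rmin_left, Rmax_right by lra. intro Hx.
    apply (continuous_ext_loc _ h).
    + generalize (locally_between A B x ltac:(lra)).
      apply filter_imp. intros y Hy. symmetry. apply is_derive_unique, HH. exact Hy.
    + apply Hh. lra.
Qed.

(** Uniform limits pass under an improper integral against a nonnegative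
    integrable weight [K]: an error at most [d] in [g] costs at most [d] times
    the integral of [K], which is below [|M| + 1] once the endpoints are close
    to [A] and [B]. *)
Lemma is_RInt_gen_unif_limit (A B : R) (K g : R -> R) (gN : nat -> R -> R)
    (M I : R) (IN : nat -> R) :
  A < B ->
  (forall t, A < t < B -> 0 <= K t) ->
  (forall t, A < t < B -> continuous K t) ->
  (forall t, A < t < B -> continuous g t) ->
  (forall eps, 0 < eps -> eventually (fun N =>
     forall t, A < t < B -> Rabs (gN N t - g t) <= eps)) ->
  is_RInt_gen K (at_right A) (at_left B) M ->
  (forall N, is_RInt_gen (fun t => K t * gN N t) (at_right A) (at_left B) (IN N)) ->
  is_lim_seq IN I ->
  is_RInt_gen (fun t => K t * g t) (at_right A) (at_left B) I.
Proof.
  intros HAB HK HKc Hgc Hu HM HN HI P [eps HP].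
  (* The total error is at most [d (|M| + 1) + d + d]: replacing [g] by [gN N],
     truncating the integral, and replacing [IN N] by [I]. *)
  set (d := eps / (Rabs M + 3)).
  assert (Hd : 0 < d).
  { unfold d. generalize (Rabs_pos M) (cond_pos eps); intros.
    apply Rdiv_lt_0_compat; lra. }
  assert (Hlim : eventually (fun N => Rabs (IN N - I) < d)).
  { apply is_lim_seq_spec in HI. exact (HI (mkposreal d Hd)). }
  destruct (filter_and _ _ Hlim (Hu d Hd)) as [N HNN].
  destruct (HNN N (Nat.le_refl N)) as [H1 H2]. clear HNN.
  assert (E1 : filter_prod (at_right A) (at_left B) (fun ab =>
     exists y, is_RInt (fun t => K t * gN N t) (fst ab) (snd ab) y /\ Rabs (y - IN N) < d)).
  { apply (HN N). exists (mkposreal d Hd). intros y Hy. exact Hy. }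
  assert (E2 : filter_prod (at_right A) (at_left B) (fun ab =>
     exists y, is_RInt K (fst ab) (snd ab) y /\ Rabs (y - M) < 1)).
  { apply HM. exists (mkposreal 1 Rlt_0_1). intros y Hy. exact Hy. }
  assert (E3 : filter_prod (at_right A) (at_left B)
     (fun ab => A < fst ab /\ fst ab < snd ab /\ snd ab < B)).
  { apply eventually_inside; trivial. intros; simpl; lra. }
  unfold filtermapi. generalize (filter_and _ _ E1 (filter_and _ _ E2 E3)).
  apply filter_imp. intros [s t]; simpl.
  intros [[y [Hy1 Hy2]] [[z [Hz1 Hz2]] [Hs [Hst Ht]]]].
  assert (Hex : ex_RInt (fun t => K t * g t) s t).
  { apply (ex_RInt_continuous (fun t => K t * g t)). intros x.
    rewrite Rmin_left, Rmax_right by lra. intro Hx.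
    apply (continuous_mult K g); [apply HKc|apply Hgc]; lra. }
  destruct Hex as [v Hv]. exists v. split; trivial. apply HP.
  change (Rabs (v - I) < eps).
  assert (Hvy : Rabs (y - v) <= d * z).
  { apply (norm_RInt_le (fun x => minus (K x * gN N x) (K x * g x)) (fun x => scal d (K x)) s t).
    - lra.
    - intros x Hx. unfold minus, plus, opp, scal, norm; simpl.
      unfold abs, mult; simpl.
      replace (K x * gN N x + - (K x * g x)) with (K x * (gN N x - g x)) by ring.
      rewrite Rabs_mult, (Rabs_pos_eq (K x)) by (apply HK; lra).
      rewrite Rmult_comm. apply Rmult_le_compat_r; [apply HK|apply H2]; lra.
    - apply (is_RInt_minus (V := R_NormedModule)); assumption.
    - apply (is_RInt_scal (V := R_NormedModule)); assumption. }
  assert (Hz : d * z <= d * (Rabs M + 1)).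
  { apply Rmult_le_compat_l; [lra|].
    generalize (Rle_abs M) (Rabs_def2 _ _ Hz2). lra. }
  assert (Htot : eps = d * (Rabs M + 1) + d + d :> R).
  { unfold d. field. generalize (Rabs_pos M); lra. }
  replace (v - I) with (- (y - v) + (y - IN N) + (IN N - I)) by ring.
  generalize (Rabs_triang (- (y - v) + (y - IN N)) (IN N - I)).
  generalize (Rabs_triang (- (y - v)) (y - IN N)).
  rewrite Rabs_Ropp. lra.
Qed.

(** On [[0, L]] every tail of the series is dominated by the tail of the
    absolutely convergent series at [L]. *)
Lemma PSeries_unif (g : nat -> R) (L eps : R) :
  Rbar_lt (Rabs L) (CV_radius g) -> 0 < eps ->
  eventually (fun N => forall u, 0 <= u <= L ->
    Rabs (sum_n (fun k => g k * u ^ k) N - PSeries g u) <= eps).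
Proof.
  intros Hr Heps.
  set (b := fun k => Rabs (g k * L ^ k)).
  assert (Hb : ex_series b) by now apply CV_disk_inside.
  assert (Hlim : is_lim_seq (sum_n b) (Series b)) by exact (Series_correct _ Hb).
  apply is_lim_seq_spec in Hlim.
  destruct (Hlim (mkposreal eps Heps)) as [N0 HN0]. simpl in HN0.
  exists N0. intros N HN u Hu. specialize (HN0 N HN).
  assert (Hle : forall k, Rabs (g k * u ^ k) <= b k).
  { intro k. unfold b. rewrite !Rabs_mult. apply Rmult_le_compat_l; [apply Rabs_pos|].
    rewrite !Rabs_pos_eq by (apply pow_le; lra). apply pow_incr; lra. }
  assert (Hex : ex_series (fun k => Rabs (g k * u ^ k))).
  { apply (ex_series_le (K := R_AbsRing) (V := R_CompleteNormedModule) _ b); trivial.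
    intro k. unfold norm; simpl; unfold abs; simpl. rewrite Rabs_Rabsolu. apply Hle. }
  assert (Hexb : ex_series (fun k => b (S N + k)%nat)) by now apply (ex_series_incr_n b).
  assert (Hex' : ex_series (fun k => Rabs (g (S N + k)%nat * u ^ (S N + k)%nat))).
  { now apply (ex_series_incr_n (fun k => Rabs (g k * u ^ k))). }
  unfold PSeries.
  rewrite (Series_incr_n (fun k => g k * u ^ k) (S N)) by
    (try lia; now apply ex_series_Rabs).
  rewrite (Series_incr_n b (S N)) in HN0 by (try lia; trivial).
  rewrite sum_n_Reals in *. simpl pred in *.
  match goal with |- Rabs (?s - (?s + ?r)) <= _ =>
    replace (s - (s + r)) with (- r) by ring end.
  rewrite Rabs_Ropp.
  eapply Rle_trans; [apply Series_Rabs; exact Hex'|].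
  eapply Rle_trans; [apply (Series_le _ (fun k => b (S N + k)%nat)); [|exact Hexb]|].
  - intro k. split; [apply Rabs_pos|apply Hle].
  - apply Rabs_def2 in HN0. lra.
Qed.

(** * The Beta kernel and its moments *)

Definition beta_kernel (a A B t : R) : R :=
  Rpower (t - A) (a - 1) * Rpower (B - t) (- a).

Lemma beta_kernel_pos a A B t : 0 < beta_kernel a A B t.
Proof. apply Rmult_lt_0_compat; apply Rpower_pos. Qed.

Lemma continuous_beta_kernel a A B t :
  A < t < B -> continuous (beta_kernel a A B) t.
Proof.
  intro Ht. apply (ex_derive_continuous (beta_kernel a A B)).
  unfold beta_kernel, Rpower. auto_derive. lra.
Qed.

Lemma monotone_bounded_limit (A B M : R) (F : R -> R) :
  A < B ->
  (forall s t, A < s -> s <= t -> t < B -> F s <= F t) ->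
  (forall t, A < t < B -> F t <= M) ->
  exists l, filterlim F (at_left B) (locally l).
Proof.
  intros HAB Hmon HM.
  destruct (completeness (fun y => exists t, A < t < B /\ y = F t)) as [l [Hl1 Hl2]].
  - exists M. intros y [t [Ht ->]]. now apply HM.
  - exists (F ((A + B) / 2)), ((A + B) / 2). split; [lra|trivial].
  - exists l. intros P [eps HP].
    assert (Hs : exists s, A < s < B /\ l - eps < F s).
    { apply Classical_Prop.NNPP. intro Hn.
      assert (l <= l - eps); [|generalize (cond_pos eps); lra].
      apply Hl2. intros y [t [Ht ->]]. apply Rnot_lt_le. intro Hlt.
      apply Hn. now exists t. }
    destruct Hs as [s [Hs1 Hs2]].
    unfold filtermap. generalize (at_left_lt s B (proj2 Hs1)). apply filter_imp.
    intros t Ht. apply HP. change (Rabs (F t - l) < eps).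
    assert (F s <= F t) by (apply Hmon; lra).
    assert (F t <= l) by (apply Hl1; exists t; split; [lra|trivial]).
    apply Rabs_def1; generalize (cond_pos eps); lra.
Qed.

Lemma nondecreasing_of_derive (A B : R) (F f : R -> R) :
  (forall t, A < t < B -> is_derive F t (f t)) ->
  (forall t, A < t < B -> 0 <= f t) ->
  forall s t, A < s -> s <= t -> t < B -> F s <= F t.
Proof.
  intros HF Hf s t Hs Hst Ht.
  destruct (MVT_gen F s t f) as [c [Hc E]].
  - intros x. rewrite Rmin_left, Rmax_right by lra. intro. apply HF; lra.
  - intros x. rewrite Rmin_left, Rmax_right by lra. intro.
    apply continuity_pt_filterlim, (ex_derive_continuous F). exists (f x). apply HF; lra.
  - rewrite Rmin_left, Rmax_right in Hc by lra.
    assert (0 <= f c * (t - s)) by (apply Rmult_le_pos; [apply Hf|]; lra). lra.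
Qed.

Lemma Rpower_le_1 x p : 0 < x -> x <= 1 -> 0 <= p -> Rpower x p <= 1.
Proof.
  intros Hx Hx1 Hp. unfold Rpower. rewrite <- exp_0.
  assert (ln x <= 0) by (rewrite <- ln_1; apply Rcomplements.ln_le; lra).
  destruct (Req_dec (p * ln x) 0) as [->|Hn]; [lra|].
  apply Rlt_le, exp_increasing. nra.
Qed.

(** An antiderivative [F] of the kernel is nondecreasing, so only an upper bound
    near 1 is needed.  For [t >= 1/2] the kernel is at most [2 (1 - t)^(-a)],
    whose antiderivative [- 2 / (1 - a) (1 - t)^(1 - a)] stays bounded. *)
Lemma beta_antideriv_limit_1 (a : R) (F : R -> R) :
  0 < a < 1 ->
  (forall t, 0 < t < 1 -> is_derive F t (beta_kernel a 0 1 t)) ->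
  exists l, filterlim F (at_left 1) (locally l).
Proof.
  intros Ha HF.
  set (G := fun t => - F t - 2 / (1 - a) * Rpower (1 - t) (1 - a)).
  assert (HG : forall t, 0 < t < 1 ->
    is_derive G t (2 * Rpower (1 - t) (- a) - beta_kernel a 0 1 t)).
  { intros t Ht.
    assert (HR : is_derive (fun y => 2 / (1 - a) * Rpower (1 - y) (1 - a)) t
                  (- 2 * Rpower (1 - t) (- a))).
    { unfold Rpower. auto_derive; [lra|].
      change (1 + - t) with (1 - t).
      fold (Rpower (1 - t) (1 - a)). fold (Rpower (1 - t) (- a)).
      rewrite (Rpower_minus_1 (1 - t) (1 - a)) by lra.
      replace (1 - a - 1) with (- a) by ring. field. lra. }
    evar_last.
    - apply (is_derive_minus (fun y => - F y)); [|exact HR].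
      apply (is_derive_opp F), HF, Ht.
    - unfold minus, plus, opp; simpl. ring. }
  apply (monotone_bounded_limit (3 / 4) 1 (- G (3 / 4))); [lra| |].
  - apply (nondecreasing_of_derive _ _ _ (beta_kernel a 0 1)).
    + intros t Ht. apply HF. lra.
    + intros t Ht. apply Rlt_le, beta_kernel_pos.
  - intros t Ht.
    assert (Hmon : G (3 / 4) <= G t).
    { apply (nondecreasing_of_derive (1 / 2) 1 G
        (fun t => 2 * Rpower (1 - t) (- a) - beta_kernel a 0 1 t)); try lra.
      - intros s Hs. apply HG. lra.
      - intros s Hs. unfold beta_kernel. rewrite Rminus_0_r.
        assert (H1 : Rpower s a <= 1) by (apply Rpower_le_1; lra).
        rewrite (Rpower_minus_1 s a) in H1 by lra.
        assert (H2 : 0 < Rpower s (a - 1)) by apply Rpower_pos.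
        assert (H3 : Rpower s (a - 1) <= 2) by nra.
        assert (H4 : 0 < Rpower (1 - s) (- a)) by apply Rpower_pos.
        nra. }
    unfold G at 2 in Hmon.
    assert (0 < 2 / (1 - a) * Rpower (1 - t) (1 - a)).
    { apply Rmult_lt_0_compat; [apply Rdiv_lt_0_compat; lra|apply Rpower_pos]. }
    lra.
Qed.

Lemma filterlim_affine_at_left (k c x : R) :
  0 < k -> filterlim (fun t => k * t + c) (at_left x) (at_left (k * x + c)).
Proof.
  intros Hk P [eps HP].
  assert (He : 0 < eps / k) by (apply Rdiv_lt_0_compat; [apply cond_pos|lra]).
  exists (mkposreal _ He). intros y Hy Hlt. apply HP.
  - change (Rabs (k * y + c - (k * x + c)) < eps).
    change (Rabs (y - x) < eps / k) in Hy.
    replace (k * y + c - (k * x + c)) with (k * (y - x)) by ring.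
    rewrite Rabs_mult, (Rabs_pos_eq k) by lra.
    apply (Rmult_lt_compat_l k) in Hy; trivial.
    replace (k * (eps / k)) with (pos eps) in Hy by (field; lra). exact Hy.
  - now apply Rplus_lt_compat_r, Rmult_lt_compat_l.
Qed.

Lemma filterlim_affine_at_right (k c x : R) :
  0 < k -> filterlim (fun t => k * t + c) (at_right x) (at_right (k * x + c)).
Proof.
  intros Hk P [eps HP].
  assert (He : 0 < eps / k) by (apply Rdiv_lt_0_compat; [apply cond_pos|lra]).
  exists (mkposreal _ He). intros y Hy Hlt. apply HP.
  - change (Rabs (k * y + c - (k * x + c)) < eps).
    change (Rabs (y - x) < eps / k) in Hy.
    replace (k * y + c - (k * x + c)) with (k * (y - x)) by ring.
    rewrite Rabs_mult, (Rabs_pos_eq k) by lra.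
    apply (Rmult_lt_compat_l k) in Hy; trivial.
    replace (k * (eps / k)) with (pos eps) in Hy by (field; lra). exact Hy.
  - now apply Rplus_lt_compat_r, Rmult_lt_compat_l.
Qed.

Lemma filterlim_reflect_at_right (c x : R) :
  filterlim (fun t => c - t) (at_right x) (at_left (c - x)).
Proof.
  intros P [eps HP]. exists eps. intros y Hy Hlt. apply HP.
  - change (Rabs (c - y - (c - x)) < eps). change (Rabs (y - x) < eps) in Hy.
    replace (c - y - (c - x)) with (- (y - x)) by ring. now rewrite Rabs_Ropp.
  - lra.
Qed.

Lemma filterlim_reflect_at_left (c x : R) :
  filterlim (fun t => c - t) (at_left x) (at_right (c - x)).
Proof.
  intros P [eps HP]. exists eps. intros y Hy Hlt. apply HP.
  - change (Rabs (c - y - (c - x)) < eps). change (Rabs (y - x) < eps) in Hy.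
    replace (c - y - (c - x)) with (- (y - x)) by ring. now rewrite Rabs_Ropp.
  - lra.
Qed.

(** The substitution [t = A + (B - A) s] carries the kernel on (A, B) to the one
    on (0, 1), the powers of [B - A] cancelling.  The limit of the antiderivative
    at 0 reduces to the limit at 1 for the exponent [1 - a], because
    [s |-> 1 - s] exchanges the two exponents. *)
Lemma beta_integral_scale_free (a : R) :
  0 < a < 1 ->
  exists M, forall A B, A < B ->
    is_RInt_gen (beta_kernel a A B) (at_right A) (at_left B) M.
Proof.
  intro Ha.
  set (F := fun t => RInt (beta_kernel a 0 1) (1 / 2) t).
  assert (HF : forall t, 0 < t < 1 -> is_derive F t (beta_kernel a 0 1 t)).
  { intros t Ht. apply (is_derive_RInt _ _ (1 / 2)).
    - generalize (locally_between 0 1 t Ht). apply filter_imp. intros y Hy. apply RInt_correct.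
      apply (ex_RInt_continuous (beta_kernel a 0 1)). intros z Hz.
      apply continuous_beta_kernel. revert Hz.
      apply Rmin_case; apply Rmax_case; lra.
    - now apply continuous_beta_kernel. }
  destruct (beta_antideriv_limit_1 a F Ha HF) as [l1 Hl1].
  destruct (beta_antideriv_limit_1 (1 - a) (fun t => - F (1 - t))) as [l0 Hl0].
  { lra. }
  { intros t Ht.
    evar_last.
    - apply (is_derive_opp (fun t => F (1 - t))).
      apply (is_derive_comp F (fun t => 1 - t)).
      + apply HF. lra.
      + auto_derive; trivial.
    - unfold beta_kernel, opp, scal, mult; simpl; unfold mult; simpl.
      replace (1 - (1 - t)) with (t - 0) by ring.
      replace (1 - a - 1) with (- a) by ring.
      replace (- (1 - a)) with (a - 1) by ring.
      rewrite Rminus_0_r. ring. }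
  assert (Hr : filterlim F (at_right 0) (locally (- l0))).
  { apply (filterlim_ext_loc (fun t => - (- F (1 - (1 - t))))).
    - apply filter_forall. intro t. rewrite Ropp_involutive. f_equal. ring.
    - apply (filterlim_comp _ _ _ (fun t => - F (1 - (1 - t))) Ropp _ (locally l0)).
      + apply (filterlim_comp _ _ _ (fun t => 1 - t) (fun t => - F (1 - t)) _ (at_left 1)).
        * replace (at_left 1) with (at_left (1 - 0)) by (f_equal; ring).
          apply filterlim_reflect_at_right.
        * exact Hl0.
      + apply (filterlim_opp (K := R_AbsRing) (V := R_NormedModule)). }
  exists (l1 - - l0). intros A B HAB.
  assert (Hk : 0 < / (B - A)) by (apply Rinv_0_lt_compat; lra).
  set (g := fun t => / (B - A) * t + (- A / (B - A))).
  assert (HgA : g A = 0) by (unfold g; field; lra).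
  assert (HgB : g B = 1) by (unfold g; field; lra).
  assert (Hg0 : forall t, g t - 0 = / (B - A) * (t - A)) by (intro; unfold g; field; lra).
  assert (Hg1 : forall t, 1 - g t = / (B - A) * (B - t)) by (intro; unfold g; field; lra).
  apply (is_RInt_gen_antideriv A B (fun t => F (g t))); trivial.
  - intros t Ht. evar_last.
    + apply (is_derive_comp F g).
      * apply HF. specialize (Hg0 t). specialize (Hg1 t).
        assert (0 < / (B - A) * (t - A)) by (apply Rmult_lt_0_compat; lra).
        assert (0 < / (B - A) * (B - t)) by (apply Rmult_lt_0_compat; lra).
        clear - Hg0 Hg1 H H0. lra.
      * unfold g. auto_derive; trivial.
    + unfold beta_kernel, scal; simpl; unfold mult; simpl.
      rewrite Hg0, Hg1, <- !Rpower_mult_distr by lra.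
      set (k := / (B - A)) in *.
      transitivity ((Rpower k 1 * Rpower k (a - 1) * Rpower k (- a))
        * (Rpower (t - A) (a - 1) * Rpower (B - t) (- a))).
      { rewrite Rpower_1 by trivial. ring. }
      rewrite <- !Rpower_plus. replace (1 + (a - 1) + - a) with 0 by ring.
      rewrite Rpower_O by trivial. ring.
  - intros t Ht. now apply continuous_beta_kernel.
  - apply (filterlim_comp _ _ _ g F _ (at_right 0)); trivial.
    rewrite <- HgA. now apply filterlim_affine_at_right.
  - apply (filterlim_comp _ _ _ g F _ (at_left 1)); trivial.
    rewrite <- HgB. now apply filterlim_affine_at_left.
Qed.

Lemma filterlim_Rpower_at_right_0 p :
  0 < p -> filterlim (fun t => Rpower t p) (at_right 0) (locally 0).
Proof.
  intros Hp P [eps HP].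
  assert (He : 0 < Rpower eps (/ p)) by apply Rpower_pos.
  exists (mkposreal _ He). intros y Hy Hlt. apply HP.
  change (Rabs (Rpower y p - 0) < eps).
  change (Rabs (y - 0) < Rpower eps (/ p)) in Hy.
  rewrite Rminus_0_r in *.
  rewrite Rabs_pos_eq in * by (apply Rlt_le; trivial; apply Rpower_pos).
  apply (Rlt_le_trans _ (Rpower (Rpower eps (/ p)) p)).
  - now apply Rlt_Rpower_l.
  - rewrite Rpower_mult, Rinv_l, Rpower_1 by (lra || apply cond_pos). lra.
Qed.

(** Used for the boundary terms of the integration by parts below. *)
Lemma squeeze_Rpower_0 (F : (R -> Prop) -> Prop) (H g : R -> R) (p C : R) :
  Filter F -> 0 < p ->
  filterlim g F (at_right 0) ->
  F (fun t => 0 <= H t <= Rpower (g t) p * C) ->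
  filterlim H F (locally 0).
Proof.
  intros HF Hp Hg HH.
  apply (filterlim_le_le (fun _ => 0) H (fun t => Rpower (g t) p * C) 0); trivial.
  - apply filterlim_const.
  - change (filterlim (fun t => Rpower (g t) p * C) F (locally 0)).
    rewrite <- (Rmult_0_l C).
    apply (filterlim_comp _ _ _ (fun t => Rpower (g t) p) (fun y => y * C) F (locally 0)).
    + apply (filterlim_comp _ _ _ g (fun y => Rpower y p) F (at_right 0)); trivial.
      now apply filterlim_Rpower_at_right_0.
    + apply (continuous_mult (fun y => y) (fun _ => C) 0).
      * apply continuous_id.
      * apply continuous_const.
Qed.

(** The function [(t - A)^(a + k) (B - t)^(1 - a)] vanishes at both ends and has
    derivative [K (t - A)^k ((a + k) (B - A) - (k + 1) (t - A))], where [K] is the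
    kernel; integrating relates the moment of order [k + 1] to that of order
    [k]. *)
Lemma beta_moments (a A B M : R) :
  0 < a < 1 -> A < B ->
  is_RInt_gen (beta_kernel a A B) (at_right A) (at_left B) M ->
  forall k,
  is_RInt_gen (fun t => beta_kernel a A B t * (t - A) ^ k) (at_right A) (at_left B)
    (M * (moment_coef a k * (B - A) ^ k)).
Proof.
  intros Ha HAB HM k. induction k as [|k IH].
  - simpl. replace (M * (1 * 1)) with M by ring.
    apply (is_RInt_gen_ext (beta_kernel a A B)); trivial.
    apply filter_forall. intros ab x _. refine (_ : @eq R _ _). ring.
  - set (H := fun t => Rpower (t - A) a * Rpower (B - t) (1 - a) * (t - A) ^ k).
    set (h := fun t => beta_kernel a A B t *
      ((a + INR k) * (B - A) * (t - A) ^ k - (INR k + 1) * (t - A) ^ S k)).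
    assert (Hpow : forall t, A < t < B -> 0 < (t - A) ^ k <= (B - A) ^ k).
    { intros t Ht. split; [apply pow_lt; lra|apply pow_incr; lra]. }
    assert (Hh : is_RInt_gen h (at_right A) (at_left B) (0 - 0)).
    { apply (is_RInt_gen_antideriv A B H); trivial.
      - intros t Ht. unfold H, Rpower. auto_derive; [lra|].
        fold (Rpower (t + - A) a). fold (Rpower (B + - t) (1 - a)).
        change (t + - A) with (t - A). change (B + - t) with (B - t).
        unfold h, beta_kernel.
        rewrite (Rpower_minus_1 (t - A) a), (Rpower_minus_1 (B - t) (1 - a)) by lra.
        replace (1 - a - 1) with (- a) by ring.
        destruct k as [|k]; [|rewrite !S_INR]; simpl; field; lra.
      - intros t Ht. apply (ex_derive_continuous h).
        unfold h, beta_kernel, Rpower. auto_derive. lra.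
      - apply (squeeze_Rpower_0 _ H (fun t => 1 * t + - A) a
          (Rpower (B - A) (1 - a) * (B - A) ^ k)); [typeclasses eauto|lra| |].
        + replace 0 with (1 * A + - A) by ring.
          apply filterlim_affine_at_right; lra.
        + generalize (at_right_gt A B HAB). apply filter_imp. intros t Ht.
          specialize (Hpow t Ht). unfold H.
          replace (1 * t + - A) with (t - A) by ring.
          generalize (Rpower_pos (t - A) a) (Rpower_pos (B - t) (1 - a)); intros P1 P2.
          split.
          * apply Rmult_le_pos; [apply Rmult_le_pos|]; lra.
          * rewrite Rmult_assoc. apply Rmult_le_compat_l; [lra|].
            apply Rmult_le_compat; try lra.
            apply Rle_Rpower_l; lra.
      - apply (squeeze_Rpower_0 _ H (fun t => B - t) (1 - a)
          (Rpower (B - A) a * (B - A) ^ k)); [typeclasses eauto|lra| |].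
        + replace 0 with (B - B) by ring. apply filterlim_reflect_at_left.
        + generalize (at_left_lt A B HAB). apply filter_imp. intros t Ht.
          specialize (Hpow t Ht). unfold H.
          generalize (Rpower_pos (t - A) a) (Rpower_pos (B - t) (1 - a)); intros P1 P2.
          split.
          * apply Rmult_le_pos; [apply Rmult_le_pos|]; lra.
          * rewrite (Rmult_comm (Rpower (t - A) a)), Rmult_assoc.
            apply Rmult_le_compat_l; [lra|].
            apply Rmult_le_compat; try lra.
            apply Rle_Rpower_l; lra. }
    generalize (INR_S_gt0 k); intro Hk.
    apply (is_RInt_gen_ext (fun t => scal (/ (INR k + 1))
      (minus (scal ((a + INR k) * (B - A)) (beta_kernel a A B t * (t - A) ^ k)) (h t)))).
    + apply filter_forall. intros ab t _. refine (_ : @eq R _ _). unfold h, minus, plus, opp, scal; simpl.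
      unfold mult; simpl. field. lra.
    + replace (M * (moment_coef a (S k) * (B - A) ^ S k))
        with (scal (/ (INR k + 1)) (minus (scal ((a + INR k) * (B - A))
                (M * (moment_coef a k * (B - A) ^ k))) (0 - 0))).
      * apply (is_RInt_gen_scal (V := R_NormedModule)).
        apply (is_RInt_gen_minus (V := R_NormedModule)); trivial.
        now apply (is_RInt_gen_scal (V := R_NormedModule)).
      * unfold minus, plus, opp, scal; cbn -[INR]. unfold mult; cbn -[INR]. field. lra.
Qed.

(** * Term-by-term integration *)

Lemma beta_integral_PSeries (a A B M : R) (g : nat -> R) :
  0 < a < 1 -> A < B ->
  is_RInt_gen (beta_kernel a A B) (at_right A) (at_left B) M ->
  Rbar_lt (Rabs (B - A)) (CV_radius g) ->
  Rbar_lt (Rabs (B - A)) (CV_radius (fun k => g k * moment_coef a k)) ->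
  is_RInt_gen (fun t => beta_kernel a A B t * PSeries g (t - A))
    (at_right A) (at_left B)
    (M * PSeries (fun k => g k * moment_coef a k) (B - A)).
Proof.
  intros Ha HAB HM Hg Hgm.
  set (gN := fun N t => sum_n (fun k => g k * (t - A) ^ k) N).
  set (b := fun k => g k * moment_coef a k).
  apply (is_RInt_gen_unif_limit A B (beta_kernel a A B) (fun t => PSeries g (t - A))
    gN M _ (fun N => M * sum_n (fun k => b k * (B - A) ^ k) N)); trivial.
  - intros t _. apply Rlt_le, beta_kernel_pos.
  - intros t Ht. now apply continuous_beta_kernel.
  - intros t Ht. apply (continuous_comp (fun t => t - A) (PSeries g)).
    + apply (ex_derive_continuous (fun t => t - A)). auto_derive; trivial.
    + apply continuity_pt_filterlim, PSeries_continuity.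
      eapply Rbar_le_lt_trans; [|exact Hg]. simpl. rewrite !Rabs_pos_eq; lra.
  - intros eps Heps.
    generalize (PSeries_unif g (B - A) eps Hg Heps).
    apply filter_imp. intros N HN t Ht. apply (HN (t - A)). lra.
  - intro N. unfold gN. induction N as [|N IH].
    + apply (is_RInt_gen_ext (fun t => scal (g O) (beta_kernel a A B t * (t - A) ^ 0))).
      * apply filter_forall. intros ab t _. refine (_ : @eq R _ _). rewrite sum_O.
        unfold scal; simpl; unfold mult; simpl. ring.
      * rewrite sum_O.
        replace (M * (b O * (B - A) ^ 0))
          with (scal (g O) (M * (moment_coef a 0 * (B - A) ^ 0))).
        -- now apply (is_RInt_gen_scal (V := R_NormedModule)), beta_moments.
        -- unfold b, scal; simpl; unfold mult; simpl. ring.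
    + apply (is_RInt_gen_ext (fun t => plus
        (beta_kernel a A B t * sum_n (fun k => g k * (t - A) ^ k) N)
        (scal (g (S N)) (beta_kernel a A B t * (t - A) ^ S N)))).
      * apply filter_forall. intros ab t _. refine (_ : @eq R _ _). rewrite sum_Sn.
        unfold scal, plus; simpl; unfold mult; simpl. ring.
      * rewrite sum_Sn.
        replace (M * plus (sum_n (fun k => b k * (B - A) ^ k) N) (b (S N) * (B - A) ^ S N))
          with (plus (M * sum_n (fun k => b k * (B - A) ^ k) N)
            (scal (g (S N)) (M * (moment_coef a (S N) * (B - A) ^ S N)))).
        -- apply (is_RInt_gen_plus (V := R_NormedModule)); trivial.
           now apply (is_RInt_gen_scal (V := R_NormedModule)), beta_moments.
        -- unfold b, scal, plus; cbn -[moment_coef pow]; unfold mult; cbn -[moment_coef pow]. ring.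
  - apply (is_lim_seq_scal_l _ M (PSeries b (B - A))).
    apply Series_correct.
    apply ex_series_Rabs, CV_disk_inside, Hgm.
Qed.

(** * The C-Legendre function as a power series *)

Lemma INR_neq_between (n k : nat) (nu : R) :
  INR n - 1 < nu < INR n -> INR k - nu <> 0.
Proof.
  intros Hnu E. assert (E' : INR k = nu) by lra.
  destruct (Nat.le_gt_cases n k) as [H|H].
  - apply le_INR in H. lra.
  - apply le_INR in H. rewrite S_INR in H. lra.
Qed.

Lemma caputo_one_minus_sqr_pow (n : nat) (nu : R) :
  0 < nu -> INR n - 1 < nu < INR n ->
  exists M, forall x, -1 < x < 1 ->
    caputo n nu (-1) (fun t => Rpower (1 - t ^ 2) nu) x =
    M * PSeries (legendre_coef nu n) (x + 1).
Proof.
  intros Hpos Hnu.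
  set (a := nu - INR n + 1).
  assert (Ha : 0 < a < 1) by (unfold a; lra).
  assert (Hk : forall k, INR k - nu <> 0) by (intro k; exact (INR_neq_between n k nu Hnu)).
  destruct (beta_integral_scale_free a Ha) as [M HM].
  exists (/ Gamma (INR n - nu) * M). intros x Hx. unfold caputo.
  rewrite Rmult_assoc. f_equal.
  apply (is_RInt_gen_unique (V := R_CompleteNormedModule)).
  assert (Hlen : x - -1 = x + 1) by ring.
  apply (is_RInt_gen_ext (fun t => beta_kernel a (-1) x t * PSeries (deriv_coef nu n) (t - -1))).
  - apply eventually_inside; [lra|]. intros s t Hs Hst Ht y; simpl.
    rewrite Rmin_left, Rmax_right by lra. intro Hy.
    rewrite Derive_n_one_minus_sqr_pow by (trivial; lra).
    unfold beta_kernel. rewrite Rpower_Ropp.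
    replace (y - -1) with (y + 1) by ring.
    replace (a - 1) with (nu - INR n) by (unfold a; ring).
    replace (nu + 1 - INR n) with a by (unfold a; ring).
    unfold Rdiv. ring.
  - rewrite <- Hlen. apply beta_integral_PSeries; trivial; try lra.
    + apply HM. lra.
    + rewrite Hlen. apply Rabs_lt_CV_radius; [now apply CV_radius_deriv_coef|lra].
    + rewrite Hlen. apply Rabs_lt_CV_radius; [|lra].
      change (Rbar_le 2 (CV_radius (legendre_coef nu n))).
      rewrite CV_radius_legendre_coef by trivial. apply Rbar_le_refl.
Qed.

Lemma is_deriveRC_scal (f : R -> R) (x l : R) (c : C) :
  is_derive f x l -> is_deriveRC (fun y => c * f y)%C x (c * l)%C.
Proof.
  intro Hf. unfold is_deriveRC.
  apply (is_derive_ext (fun y => scal (V := C_R_NormedModule) (f y) c)).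
  - intro y. change ((f y * fst c, f y * snd c) = (c * f y)%C).
    unfold Cmult, RtoC. simpl. f_equal; ring.
  - evar_last; [exact (is_derive_scal_l (V := C_R_NormedModule) f x l c Hf)|].
    change ((l * fst c, l * snd c) = (c * l)%C).
    unfold Cmult, RtoC. simpl. f_equal; ring.
Qed.

Lemma is_derive_PSeries_shift (s : nat -> R) (x : R) :
  Rbar_lt (Rabs (x + 1)) (CV_radius s) ->
  is_derive (fun y => PSeries s (y + 1)) x (PSeries (PS_derive s) (x + 1)).
Proof.
  intro H. evar_last.
  - apply (is_derive_comp (PSeries s) (fun y => y + 1)).
    + apply is_derive_PSeries, H.
    + auto_derive; trivial.
  - unfold scal; simpl; unfold mult; simpl. ring.
Qed.

Theorem proposition3p16 :
  forall (n : nat) (nu : R),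
    (1 <= n)%nat ->
    INR n - 1 < nu < INR n ->
    exists P' P'' : R -> C,
      forall x : R, -1 < x < 1 ->
        is_deriveRC (C_Legendre n nu) x (P' x) /\
        is_deriveRC P' x (P'' x) /\
        ((1 - x ^ 2)%R * P'' x - (2 * x)%R * P' x
         + (nu * (nu + 1))%R * C_Legendre n nu x = 0)%C.
Proof.
  intros n nu Hn Hnu.
  assert (Hpos : 0 < nu) by (apply le_INR in Hn; simpl in Hn; lra).
  assert (Hk : forall k, INR k - nu <> 0) by (intro k; exact (INR_neq_between n k nu Hnu)).
  destruct (caputo_one_minus_sqr_pow n nu Hpos Hnu) as [M HM].
  set (s := legendre_coef nu n).
  set (c := (neg1_pow nu / (Rpower 2 nu * Gamma (nu + 1))%R * M)%C).
  assert (HP : forall x, -1 < x < 1 -> C_Legendre n nu x = (c * PSeries s (x + 1))%C).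
  { intros x Hx. unfold C_Legendre, c. rewrite HM by trivial.
    rewrite (RtoC_mult M). fold s. ring. }
  assert (Hr : CV_radius s = 2) by now apply CV_radius_legendre_coef.
  assert (Hin : forall x, -1 < x < 1 -> Rbar_lt (Rabs (x + 1)) (CV_radius s)).
  { intros x Hx. apply Rabs_lt_CV_radius; [|lra]. rewrite Hr. apply Rbar_le_refl. }
  exists (fun x => c * PSeries (PS_derive s) (x + 1))%C.
  exists (fun x => c * PSeries (PS_derive (PS_derive s)) (x + 1))%C.
  intros x Hx. split; [|split].
  - apply (is_derive_ext_loc (V := C_R_NormedModule) (fun y => c * PSeries s (y + 1))%C).
    + generalize (locally_between (-1) 1 x Hx). apply filter_imp. intros y Hy. symmetry. now apply HP.
    + apply is_deriveRC_scal, is_derive_PSeries_shift, Hin, Hx.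
  - apply is_deriveRC_scal, is_derive_PSeries_shift.
    rewrite CV_radius_derive. apply Hin, Hx.
  - rewrite HP by trivial.
    assert (E := legendre_series_ode nu n (x + 1) Hpos Hk ltac:(lra)). cbv zeta in E.
    fold s in E.
    transitivity (c * RtoC ((x + 1) * (2 - (x + 1)) * PSeries (PS_derive (PS_derive s)) (x + 1)
      - 2 * (x + 1 - 1) * PSeries (PS_derive s) (x + 1)
      + nu * (nu + 1) * PSeries s (x + 1)))%C.
    + unfold Cmult, Cplus, Cminus, Copp, RtoC. simpl. f_equal; ring.
    + rewrite E. ring.
Qed.
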